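(* Let $x_m>0$, let $f:(0,x_m]\to(0,\infty)$ be an integrable expected loss function, let $r:(0,x_m]\to\mathbb{R}$ be a Riemann integrable retention function with $0\le r(x)\le x$ for all $x$, let $\rho>0$, let the Insured have disutility function $U(l)=\rho(e^{l/\rho}-1)$, and let $P\geq 0$ be the policy premium. Let $\tilde X$ and $\tilde R$ be the yearly total loss and the yearly total retention. Then $$CE(\tilde X)=\rho\int_0^{x_m}f(x)\left(e^{x/\rho}-1\right)dx,\qquad CE(\tilde R+P)=P+\rho\int_0^{x_m}f(x)\left(e^{r(x)/\rho}-1\right)dx,$$ and consequently the policy value $V_{ins}=CE(\tilde X)-CE(\tilde R+P)$ is $$V_{ins}=\rho\int_0^{x_m}f(x)\left(e^{x/\rho}-e^{r(x)/\rho}\right)dx-P .$$ In particular, if the premium is $P=(1+c)\int_0^{x_m}f(x)\,(x-r(x))\,dx$ with loading coefficient $c$, then $$V_{ins}=\rho\int_0^{x_m}f(x)\left(e^{x/\rho}-e^{r(x)/\rho}-(1+c)\left(\frac{x}{\rho}-\frac{r(x)}{\rho}\right)\right)dx .$$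
   Context: Losses have positive values $x\in(0,x_m]$. The expected loss function $f$ is such that $\int_{x_1}^{x_2}f(x)\,dx$ is the expected number of losses per year with value in $(x_1,x_2]\subseteq(0,x_m]$. For each such interval the yearly number of losses $\tilde n_{x_1,x_2;f}$ with value in $(x_1,x_2]$ is a Poisson random variable with mean $\int_{x_1}^{x_2}f(x)\,dx$, and the variables associated with disjoint intervals are mutually independent. The retention function $r$ gives the part $r(x)$ of a loss of value $x$ borne by the Insured; $i(x)=x-r(x)$ is the indemnity. For a partition $0=x_0<x_1<\dots<x_\chi=x_m$ with representative points $\xi_j\in(x_{j-1},x_j]$, put $\tilde n_j=\tilde n_{x_{j-1},x_j;f}$ and consider the discretized yearly total loss $\sum_{j=1}^\chi\tilde n_j\,\xi_j$ and the discretized yearly total retention $\sum_{j=1}^\chi\tilde n_j\,r(\xi_j)$. The yearly total loss $\tilde X$ and total retention $\tilde R$ are understood as the limits of these as the mesh $\max_j(x_j-x_{j-1})$ tends to $0$; the expected disutilities are defined as $$\langle U(\tilde X)\rangle=\lim \Big\langle U\Big(\sum_{j}\tilde n_j\xi_j\Big)\Big\rangle,\qquad \langle U(\tilde R+P)\rangle=\lim\Big\langle U\Big(P+\sum_{j}\tilde n_j r(\xi_j)\Big)\Big\rangle$$ as the mesh tends to $0$, where $\langle\cdot\rangle$ denotes expected value. The certain equivalent of an uncertain amount $\tilde\Phi$ is $CE(\tilde\Phi)=U^{-1}(\langle U(\tilde\Phi)\rangle)$. *)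

(* Defs.v *)
From HB Require Import structures.
From mathcomp Require Import all_boot all_order all_algebra.
From mathcomp Require Import finmap.
From mathcomp Require Import all_classical all_reals all_analysis.

Set Implicit Arguments.
Unset Strict Implicit.
Unset Printing Implicit Defensive.

Import Order.TTheory GRing.Theory Num.Theory.
Import numFieldNormedType.Exports.

Local Open Scope classical_set_scope.
Local Open Scope ring_scope.

(* Integrals are Lebesgue integrals over half-open intervals. The measure is
   the completed one, so that a Riemann integrable function, which may fail to
   be Borel measurable, is still measurable. *)
Definition integral_oc (R : realType) (a b : R) (g : R -> R) : R :=
  Rintegral (@completed_lebesgue_measure R) `]a, b] g.

Definition integrable_oc (R : realType) (a b : R) (g : R -> R) : Prop :=
  (@completed_lebesgue_measure R).-integrable `]a, b] (EFin \o g).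

(* The cells are numbered from 0: cell j is `]tp_pt j, tp_pt j.+1], and its
   representative point is tp_tag j. *)
Record tagged_partition (R : realType) (xm : R) := TaggedPartition {
  tp_size : nat;
  tp_pt : nat -> R;
  tp_tag : nat -> R;
  tp_pt_first : tp_pt 0%N = 0;
  tp_pt_last : tp_pt tp_size = xm;
  tp_pt_lt : forall j, (j < tp_size)%N -> tp_pt j < tp_pt j.+1;
  tp_tag_in : forall j, (j < tp_size)%N -> tp_pt j < tp_tag j <= tp_pt j.+1
}.

Definition mesh (R : realType) (xm : R) (p : tagged_partition xm) : R :=
  \big[Num.max/0]_(j < tp_size p) (tp_pt p j.+1 - tp_pt p j).

(* Convergence along this filter is convergence as the mesh tends to 0,
   uniformly in the choice of the representative points. *)
Definition mesh_to0 (R : realType) (xm : R) : set_system (tagged_partition xm) :=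
  filter_from [set d : R | 0 < d] (fun d => [set p | mesh p < d]).

Definition riemann_sum (R : realType) (xm : R) (g : R -> R)
    (p : tagged_partition xm) : R :=
  \sum_(j < tp_size p) g (tp_tag p j) * (tp_pt p j.+1 - tp_pt p j).

(* The tags never take the value 0, where g need not be defined. For bounded g
   this is Riemann integrability on [0, xm] of any extension of g to 0. *)
Definition riemann_integrable (R : realType) (xm : R) (g : R -> R) : Prop :=
  cvg (riemann_sum g p @[p --> @mesh_to0 R xm]).

Definition mutually_independent (R : realType) (d d' : measure_display)
    (Omega : measurableType d) (T : measurableType d') (Pr : probability Omega R)
    (I : choiceType) (D : set I) (X : I -> {RV Pr >-> T}) : Prop :=
  forall J : {fset I}, [set` J] `<=` D ->
  forall A : I -> set T, (forall i, measurable (A i)) ->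
  Pr (\bigcap_(i in [set` J]) (X i @^-1` A i)) =
    (\prod_(i <- J) Pr (X i @^-1` A i))%E.

(* The pair (a, b) stands for the interval `]a, b]. *)
Definition loss_intervals (R : realType) (xm : R) : set (R * R) :=
  [set ab | [/\ 0 <= ab.1, ab.1 < ab.2 & ab.2 <= xm]].

(* N (a, b) is the yearly number of losses with value in `]a, b]. The means are
   positive below, since f is, so poisson_pmf is the usual mass function. *)
Definition poisson_loss_counts (R : realType) (d : measure_display)
    (Omega : measurableType d) (Pr : probability Omega R)
    (xm : R) (f : R -> R) (N : R * R -> {RV Pr >-> nat}) : Prop :=
  (forall ab, loss_intervals xm ab -> forall k : nat,
     distribution Pr (N ab) [set k] =
       (poisson_pmf (integral_oc ab.1 ab.2 f) k)%:E) /\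
  (forall D : set (R * R), D `<=` loss_intervals xm ->
     trivIset D (fun ab => [set` `]ab.1, ab.2]]) ->
     mutually_independent D N).

(* With g = id this is the discretized yearly total loss, with g = r the
   discretized yearly total retention. *)
Definition discretized_total (R : realType) (d : measure_display)
    (Omega : measurableType d) (Pr : probability Omega R)
    (N : R * R -> {RV Pr >-> nat}) (xm : R) (g : R -> R)
    (p : tagged_partition xm) (w : Omega) : R :=
  \sum_(j < tp_size p) (N (tp_pt p j, tp_pt p j.+1) w)%:R * g (tp_tag p j).

(* In the next definitions an uncertain amount Y is given by its
   discretizations, one random amount per tagged partition. *)
Definition expected_disutility (R : realType) (d : measure_display)
    (Omega : measurableType d) (Pr : probability Omega R) (U : R -> R)
    (xm : R) (Y : tagged_partition xm -> Omega -> R) : \bar R :=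
  lim ('E_Pr[fun w => U (Y p w)]%E @[p --> @mesh_to0 R xm]).

Definition certain_equivalent (R : realType) (d : measure_display)
    (Omega : measurableType d) (Pr : probability Omega R) (U : R -> R)
    (xm : R) (Y : tagged_partition xm -> Omega -> R) : R :=
  'pinv_(fun=> 0) [set: R] U (fine (expected_disutility Pr U Y)).

(* lim, fine and 'pinv are total functions. Their values above are the intended
   ones when the limit exists, is finite and lies in the range of U. *)
Definition certain_equivalent_defined (R : realType) (d : measure_display)
    (Omega : measurableType d) (Pr : probability Omega R) (U : R -> R)
    (xm : R) (Y : tagged_partition xm -> Omega -> R) : Prop :=
  exists2 u : R, range U u &
    'E_Pr[fun w => U (Y p w)]%E @[p --> @mesh_to0 R xm] --> u%:E.

Definition exp_disutility (R : realType) (rho l : R) : R :=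
  rho * (expR (l / rho) - 1).

(* Main.v *)
(* On a partition the counts n_j are independent Poisson variables with means
   m_j, so the exponential moment of their sum factors:
   E exp (sum n_j g(xi_j) / rho) = exp (sum m_j (exp (g(xi_j) / rho) - 1)).
   The exponent is a Riemann-type sum for the integral of f (exp (g / rho) - 1),
   with the masses m_j in place of lengths. Its error is at most a constant
   times the sum over the cells of (oscillation of g) * m_j. Truncating f at a
   level K bounds this by K times a Darboux gap of g, which tends to 0 by Riemann
   integrability, plus the integral of the excess of f over K, which is small
   for K large. Since U is injective, the certain equivalents can be read off
   the limits. *)
Require Import Defs.
From HB Require Import structures.
From mathcomp Require Import all_boot all_order all_algebra.
From mathcomp Require Import finmap ring lra.
From mathcomp Require Import all_classical all_reals all_analysis.
From mathcomp Require Import measurable_realfun.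

Set Implicit Arguments.
Unset Strict Implicit.
Unset Printing Implicit Defensive.

Import Order.TTheory GRing.Theory Num.Theory.
Import numFieldNormedType.Exports.

Local Open Scope classical_set_scope.
Local Open Scope ring_scope.

(** * Expectations of products of independent counts, and the Poisson exponential moment *)

Section nat_valued_random_variables.
Context (R : realType) (d : measure_display) (Omega : measurableType d)
  (Pr : probability Omega R).
Local Open Scope ereal_scope.

Lemma measurable_preimage_nat (Y : {RV Pr >-> nat}) (A : set nat) :
  measurable (Y @^-1` A).
Proof. by rewrite -[X in measurable X]setTI; exact: measurable_funP. Qed.

Lemma measurable_comp_nat (Y : {RV Pr >-> nat}) (phi : nat -> R) :
  measurable_fun [set: Omega] (fun w => phi (Y w)).
Proof. exact: (measurableT_comp (f := phi)). Qed.

(** Countable additivity over the disjoint fibers of [Y]; since [G] is nonnegative, no integrability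
    is assumed and the value may be infinite. *)
Lemma integral_nat_fibers (Y : {RV Pr >-> nat}) (D : set Omega)
    (G : Omega -> \bar R) :
  measurable D -> measurable_fun D G -> (forall w, 0 <= G w) ->
  \int[Pr]_(w in D) G w =
  \sum_(m <oo) \int[Pr]_(w in D `&` Y @^-1` [set m]) G w.
Proof.
move=> mD mG G0.
have DE : D = \bigcup_m (D `&` Y @^-1` [set m]).
  apply/seteqP; split => [w Dw|w [m _ []]//].
  by exists (Y w).
rewrite [in LHS]DE ge0_integral_bigcup//.
- by move=> m; apply: measurableI => //; exact: measurable_preimage_nat.
- by rewrite -DE.
- move=> i j _ _ [w [[_ /= <-] [_ /= <-]]] //.
Qed.

Lemma expectation_nat_series (Y : {RV Pr >-> nat}) (phi : nat -> R) :
  (forall m, 0 <= phi m)%R ->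
  \int[Pr]_w (phi (Y w))%:E =
  \sum_(m <oo) (phi m)%:E * Pr (Y @^-1` [set m]).
Proof.
move=> phi0; rewrite (integral_nat_fibers Y)//; first last.
- by move=> w; rewrite lee_fin.
- by apply/measurable_EFinP; exact: measurable_comp_nat.
apply: eq_eseriesr => m _; rewrite setTI.
rewrite (eq_integral (fun=> (phi m)%:E)); last first.
  by move=> w; rewrite inE/= => ->.
by rewrite integral_cst//; exact: measurable_preimage_nat.
Qed.

Lemma measurable_prod_nat (Y : nat -> {RV Pr >-> nat})
    (phi : nat -> nat -> R) (k : nat) :
  measurable_fun [set: Omega] (fun w => \prod_(j < k) phi j (Y j w))%R.
Proof.
elim: k => [|k IH].
  by under eq_fun do rewrite big_ord0; exact: measurable_cst.
under eq_fun do rewrite big_ord_recr.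
by apply: measurable_funM => //; exact: measurable_comp_nat.
Qed.

(* The domain of integration carries the factors not yet integrated, so that
   the induction moves one variable at a time from events to factors. *)
Lemma integral_prod_indep (Y : nat -> {RV Pr >-> nat}) (n : nat)
    (phi : nat -> nat -> R) (e : nat -> R) :
  (forall A : nat -> set nat,
    Pr (\bigcap_(j in `I_n) (Y j @^-1` A j)) =
    \prod_(0 <= j < n) Pr (Y j @^-1` A j)) ->
  (forall j m, 0 <= phi j m)%R ->
  (forall j, (j < n)%N -> \int[Pr]_w (phi j (Y j w))%:E = (e j)%:E) ->
  forall k, (k <= n)%N -> forall A : nat -> set nat,
  \int[Pr]_(w in \bigcap_(j in [set j | (k <= j < n)%N]) (Y j @^-1` A j))
      (\prod_(j < k) phi j (Y j w))%:E =
  (\prod_(j < k) e j)%:E * \prod_(k <= j < n) Pr (Y j @^-1` A j).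
Proof.
move=> indep phi0 phie; elim=> [|k IH] kn A.
  under eq_integral do rewrite big_ord0.
  rewrite integral_cst/=; last first.
    by apply: bigcap_measurableType => j _; exact: measurable_preimage_nat.
  by rewrite big_ord0 !mul1e -indep; congr (Pr _).
(* [A' m] adds the event [Y k = m] to the family, so that each fiber of [Y k] inside the domain is a
   domain covered by the induction hypothesis. *)
pose A' m j := if j == k then [set m] else A j.
rewrite (integral_nat_fibers (Y k)); first last.
- by move=> w; rewrite lee_fin prodr_ge0.
- apply: measurable_funTS; apply/measurable_EFinP.
  exact: (measurable_prod_nat Y phi k.+1).
- by apply: bigcap_measurableType => j _; exact: measurable_preimage_nat.
set q := \prod_(k.+1 <= j < n) Pr (Y j @^-1` A j).
have q_fin : q \is a fin_num.
  by apply: prode_fin_num => j _;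
    exact: fin_num_measure (measurable_preimage_nat _ _).
(* The factor [e k] is expanded into the series over the values of [Y k], so that both sides are
   series over [m], compared term by term. Finiteness of [q] allows it to move inside the series. *)
rewrite big_ord_recr/= EFinM -phie// expectation_nat_series// -(fineK q_fin).
rewrite muleAC -EFinM -nneseriesZl; last first.
  by move=> m _; rewrite mule_ge0// lee_fin.
apply: eq_eseriesr => m _.
have -> : \bigcap_(j in [set j | (k < j < n)%N]) (Y j @^-1` A j) `&`
          Y k @^-1` [set m] =
          \bigcap_(j in [set j | (k <= j < n)%N]) (Y j @^-1` A' m j).
  apply/seteqP; split=> [w [Aw /= Yk] j /= /andP[kj jn]|w Aw].
    rewrite /A'; case: eqVneq => [->//|jk]; apply: Aw => /=.
    by rewrite jn andbT ltn_neqAle eq_sym jk.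
  split=> [j /= /andP[kj jn]|/=].
    have := Aw j; rewrite /= (ltnW kj) jn => /(_ isT).
    by rewrite /A' gtn_eqF.
  by have := Aw k; rewrite /= leqnn kn => /(_ isT); rewrite /A' eqxx.
(* On the fiber the last factor is the constant [phi k m], which leaves a product of [k] factors. *)
rewrite (eq_integral (fun w =>
    (phi k m)%:E * (\prod_(j < k) phi j (Y j w))%:E)); last first.
  move=> w; rewrite inE => /(_ k); rewrite /= leqnn kn => /(_ isT).
  rewrite /A' eqxx /= => Yk.
  by rewrite big_ord_recr/= Yk EFinM muleC.
rewrite ge0_integralZl//; first last.
- by rewrite lee_fin.
- by move=> w _; rewrite lee_fin prodr_ge0.
- apply: measurable_funTS; apply/measurable_EFinP.
  exact: (measurable_prod_nat Y phi k).
- by apply: bigcap_measurableType => j _; exact: measurable_preimage_nat.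
rewrite IH; last exact: ltnW.
rewrite big_ltn// {1}/A' eqxx.
rewrite (@eq_big_nat _ _ _ k.+1 n _ (fun j => Pr (Y j @^-1` A j))); last first.
  by move=> j /andP[kj _]; rewrite /A' gtn_eqF.
rewrite -/q EFinM fineK//.
by rewrite [RHS]muleCA; congr (_ * _); rewrite muleA [RHS]muleAC.
Qed.

(** The end of the induction, [k = n]: every variable has become a factor, and the intersection of
    events runs over no index. *)
Lemma expectation_prod_indep (Y : nat -> {RV Pr >-> nat}) (n : nat)
    (phi : nat -> nat -> R) (e : nat -> R) :
  (forall A : nat -> set nat,
    Pr (\bigcap_(j in `I_n) (Y j @^-1` A j)) =
    \prod_(0 <= j < n) Pr (Y j @^-1` A j)) ->
  (forall j m, 0 <= phi j m)%R ->
  (forall j, (j < n)%N -> \int[Pr]_w (phi j (Y j w))%:E = (e j)%:E) ->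
  \int[Pr]_w (\prod_(j < n) phi j (Y j w))%:E = (\prod_(j < n) e j)%:E.
Proof.
move=> indep phi0 phie.
have := integral_prod_indep indep phi0 phie (leqnn n) (fun=> setT).
rewrite [X in _ * X]big_geq// mule1 => <-.
rewrite (_ : \bigcap_(j in _) _ = setT)//.
by apply/seteqP; split=> // w _ j /= /andP[nj /(leq_ltn_trans nj)]; rewrite ltnn.
Qed.

(** Exponential tilting: [expR (a * m)] times the Poisson mass at [m] for [rate] is
    [expR (rate * (expR a - 1))] times the Poisson mass at [m] for [rate * expR a], and the latter
    masses sum to 1. *)
Lemma poisson_exp_moment (Y : {RV Pr >-> nat}) (rate a : R) : (0 < rate)%R ->
  (forall k, Pr (Y @^-1` [set k]) = (poisson_pmf rate k)%:E) ->
  \int[Pr]_w (expR (a * (Y w)%:R))%:E = (expR (rate * (expR a - 1)))%:E.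
Proof.
move=> rate0 PY.
rewrite (@expectation_nat_series Y (fun m => expR (a * m%:R)))//.
pose rate' := (rate * expR a)%R.
have rate'0 : (0 < rate')%R by rewrite mulr_gt0// expR_gt0.
transitivity (\sum_(m <oo)
    (expR (rate * (expR a - 1)))%:E * (poisson_pmf rate' m)%:E).
  apply: eq_eseriesr => m _; rewrite PY -!EFinM; congr EFin.
  rewrite /poisson_pmf rate0 rate'0 /rate' mulrBr mulr1 expRD exprMn.
  rewrite [expR (- (_ * expR _))]expRN expRM_natr.
  have : expR (rate * expR a) != 0%R by rewrite gt_eqF// expR_gt0.
  move: (expR (rate * expR a)) => u u0.
  have m0 : m`!%:R != 0%R :> R by rewrite pnatr_eq0 -lt0n fact_gt0.
  by field; rewrite u0 m0.
rewrite nneseriesZl; last by move=> m _; rewrite lee_fin poisson_pmf_ge0.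
have : poisson_prob rate' 0 [set: nat] = 1 by exact: probability_setT.
rewrite /poisson_prob rate'0.
rewrite -nneseries_esumT; last by move=> *; rewrite lee_fin poisson_pmf_ge0.
by move=> ->; rewrite mule1.
Qed.

End nat_valued_random_variables.

(** * Tagged partitions and the loss counts *)

Section tagged_partitions.
Context (R : realType) (xm : R).
Implicit Types p : tagged_partition xm.

Lemma tp_pt_ltn p i j : (i < j <= tp_size p)%N -> tp_pt p i < tp_pt p j.
Proof.
elim: j => [//|j IH] /andP[]; rewrite ltnS leq_eqVlt => /orP[/eqP ->|ij] jn.
  exact: tp_pt_lt.
by apply: lt_trans (tp_pt_lt jn); apply: IH; rewrite ij ltnW.
Qed.

Lemma tp_pt_leq p i j : (i <= j <= tp_size p)%N -> tp_pt p i <= tp_pt p j.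
Proof.
by rewrite leq_eqVlt => /andP[/predU1P[->//|ij] jn]; rewrite ltW// tp_pt_ltn ?ij.
Qed.

Lemma tp_pt_ge0 p j : (j <= tp_size p)%N -> 0 <= tp_pt p j.
Proof. by move=> jp; rewrite -{1}(tp_pt_first p) tp_pt_leq. Qed.

Lemma tp_pt_le_last p j : (j <= tp_size p)%N -> tp_pt p j <= xm.
Proof.
move=> jp; apply: (@le_trans _ _ (tp_pt p (tp_size p))).
  by rewrite tp_pt_leq// jp/=.
by rewrite tp_pt_last.
Qed.

Definition tp_cell p (j : nat) : set R := `]tp_pt p j, tp_pt p j.+1]%classic.

Lemma tp_cell_uniq p i j x : (i < tp_size p)%N -> (j < tp_size p)%N ->
  tp_cell p i x -> tp_cell p j x -> i = j.
Proof.
rewrite /tp_cell/= !in_itv/= => ip jp /andP[ix xi] /andP[jx xj].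
apply/eqP; case: ltngtP => // [ij|ji].
- have : tp_pt p i.+1 <= tp_pt p j by rewrite tp_pt_leq// ij ltnW.
  by move=> /(le_trans xi)/(lt_le_trans jx); rewrite ltxx.
- have : tp_pt p j.+1 <= tp_pt p i by rewrite tp_pt_leq// ji ltnW.
  by move=> /(le_trans xj)/(lt_le_trans ix); rewrite ltxx.
Qed.

Lemma tp_cell_tag p j : (j < tp_size p)%N -> tp_cell p j (tp_tag p j).
Proof. by move=> jp; rewrite /tp_cell/= in_itv/=; exact: tp_tag_in. Qed.

Lemma tp_cell_sub p j : (j < tp_size p)%N -> tp_cell p j `<=` `]0, xm].
Proof.
move=> jp x; rewrite /tp_cell/= !in_itv/= => /andP[jx xj].
apply/andP; split; first by apply: le_lt_trans jx; exact/tp_pt_ge0/ltnW.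
by apply: (le_trans xj); exact: tp_pt_le_last.
Qed.

Lemma bigcup_tp_cell p :
  \bigcup_(j in `I_(tp_size p)) tp_cell p j = `]0, xm]%classic.
Proof.
apply/seteqP; split=> [x [j /= jp]|x]; first exact: tp_cell_sub.
rewrite /= in_itv/= => /andP[x0 xxm].
(* The first division point at or beyond [x] is not [tp_pt p 0], as [x > 0]; hence [x] lies in the
   cell that ends there. *)
have [|j xj jmin] := @ex_minnP (fun j => x <= tp_pt p j).
  by exists (tp_size p); rewrite tp_pt_last.
have jn : (j <= tp_size p)%N by apply: jmin; rewrite tp_pt_last.
case: j xj jmin jn => [|j] xj jmin jn.
  by move: xj; rewrite tp_pt_first leNgt x0.
exists j => //; rewrite /tp_cell/= in_itv/= xj andbT ltNge.
by apply/negP => /jmin; rewrite ltnn.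
Qed.

Lemma loss_intervals_tp p j : (j < tp_size p)%N ->
  loss_intervals xm (tp_pt p j, tp_pt p j.+1).
Proof.
move=> jp; split => /=; last 1 first.
- exact: tp_pt_le_last.
- exact/tp_pt_ge0/ltnW.
- exact: tp_pt_lt.
Qed.

End tagged_partitions.

(** * Half-open intervals under the completed Lebesgue measure *)

Section completed_lebesgue.
Context (R : realType).
Local Notation mu := (@completed_lebesgue_measure R).

Lemma measurable_oc (a b : R) : measurable
  (`]a, b]%classic : set (caratheodory_type (@wlength R idfun)^*%mu)).
Proof. by apply: sub_caratheodory; exact: measurable_itv. Qed.

Lemma completed_lebesgue_measure_oc (a b : R) : a <= b ->
  mu `]a, b]%classic = (b - a)%:E.
Proof.
(* The completed measure and Lebesgue measure have the same values by conversion. *)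
move=> ab; rewrite -[LHS]/(@lebesgue_measure R `]a, b]%classic).
by rewrite lebesgue_measure_itv/= lte_fin; case: ltgtP ab => // ->; rewrite subrr.
Qed.

(** If the integral were 0, [f] would vanish almost everywhere, so the interval itself would be null
    although its length is positive. This makes the Poisson means positive. *)
Lemma integral_oc_gt0 (a b : R) (f : R -> R) : a < b ->
  integrable_oc a b f -> (forall x, a < x <= b -> 0 < f x) ->
  0 < integral_oc a b f.
Proof.
move=> ab f_int f_pos; rewrite lt0r Rintegral_ge0 ?andbT; last first.
  by move=> x /=; rewrite in_itv/= => /f_pos/ltW.
apply/negP => /eqP int0.
have mD := measurable_oc a b.
have : (\int[mu]_(x in `]a, b]%classic) `|(f x)%:E| = 0)%E.
  transitivity (\int[mu]_(x in `]a, b]%classic) (f x)%:E)%E.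
    apply: eq_integral => x; rewrite inE/= in_itv/= => /f_pos/ltW f0.
    by rewrite ger0_norm.
  by rewrite -[LHS]fineK ?integrable_fin_num// -[RHS]/(0%:E) -int0.
move=> /(ae_eq_integral_abs mu mD (measurable_int _ f_int)) f0.
have : (mu `]a, b]%classic = 0)%E.
  apply/(negligibleP mu mD).
  apply: negligibleS f0 => x /= abx; move: (abx).
  rewrite in_itv/= => /f_pos fx0 /(_ abx)[] fx; rewrite fx ltxx in fx0.
  by [].
by rewrite completed_lebesgue_measure_oc ?ltW// => -[] /eqP; rewrite subr_eq0 gt_eqF.
Qed.

End completed_lebesgue.

(** * Independence and exponential moments of the counts on the cells of a partition *)

Section loss_counts.
Context (R : realType) (xm : R).
Implicit Types p : tagged_partition xm.

Context (d : measure_display) (Omega : measurableType d)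
  (Pr : probability Omega R) (f : R -> R) (N : R * R -> {RV Pr >-> nat}).
Context (hN : poisson_loss_counts xm f N).

(** Independence is assumed for finite sets of disjoint intervals; here it is restated for the
    indices of the cells, the form used by [expectation_prod_indep]. *)
Lemma loss_counts_indep p (A : nat -> set nat) :
  Pr (\bigcap_(j in `I_(tp_size p))
        (N (tp_pt p j, tp_pt p j.+1) @^-1` A j)) =
  (\prod_(0 <= j < tp_size p) Pr (N (tp_pt p j, tp_pt p j.+1) @^-1` A j))%E.
Proof.
pose h j := (tp_pt p j, tp_pt p j.+1).
set n := tp_size p.
have h_inj i j : (i < n)%N -> (j < n)%N -> h i = h j -> i = j.
  move=> ip jp [hij _]; apply/eqP; case: ltngtP => // [ij|ji].
  - by have := @tp_pt_ltn _ _ p i j; rewrite ij (ltnW jp) hij ltxx => /(_ isT).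
  - by have := @tp_pt_ltn _ _ p j i; rewrite ji (ltnW ip) hij ltxx => /(_ isT).
(* [A'] carries the events from indices to intervals. By injectivity of [h] a single condition
   remains at [h j]; a pair that is no cell gets the full set. *)
pose A' ab : set nat := [set m | forall j, (j < n)%N -> h j = ab -> A j m].
have A'E j : (j < n)%N -> A' (h j) = A j.
  move=> jn; apply/seteqP; split=> m; rewrite /A'/=; first exact.
  by move=> Ajm i iin /h_inj -> //.
pose J : {fset R * R} := [fset h j | j in iota 0 n]%fset.
have Dsub : [set h j | j in `I_n] `<=` loss_intervals xm.
  by move=> _ [j /= jn <-]; exact: loss_intervals_tp.
have Dtriv : trivIset [set h j | j in `I_n]
    (fun ab => [set` `]ab.1, ab.2]]).
  move=> _ _ [i /= iin <-] [j /= jn <-] [x [xi xj]].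
  by congr h; exact: (tp_cell_uniq iin jn xi xj).
have JD : [set` J] `<=` [set h j | j in `I_n].
  by move=> _ /imfsetP[j /= + ->]; rewrite mem_iota/= add0n; exists j.
have := hN.2 _ Dsub Dtriv J JD A' (fun=> I).
have -> : \bigcap_(i in [set` J]) (N i @^-1` A' i) =
          \bigcap_(j in `I_n) (N (h j) @^-1` A j).
  apply/seteqP; split=> w Hw.
    move=> j /= jn; rewrite -(A'E j jn); apply: Hw => /=.
    by apply/imfsetP; exists j => //=; rewrite mem_iota.
  move=> _ /imfsetP[j /= + ->]; rewrite mem_iota/= add0n => jn.
  by rewrite A'E//; exact: Hw.
move=> ->; rewrite big_imfset/=; last first.
  by move=> i j; rewrite !mem_iota/= !add0n; exact: h_inj.
rewrite -[X in iota _ X]subn0 -/(index_iota 0 n) undup_id ?iota_uniq//.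
by apply: eq_big_nat => j /andP[_ jn]; rewrite A'E.
Qed.

Lemma expectation_exp_loss_counts p (a : nat -> R) :
  (forall x, 0 < x <= xm -> 0 < f x) -> integrable_oc 0 xm f ->
  (\int[Pr]_w (\prod_(j < tp_size p)
     expR (a j * (N (tp_pt p j, tp_pt p j.+1) w)%:R))%:E)%E =
  (expR (\sum_(j < tp_size p)
     integral_oc (tp_pt p j) (tp_pt p j.+1) f * (expR (a j) - 1)))%:E.
Proof.
move=> f_pos f_int.
rewrite (@expectation_prod_indep _ _ _ _ (fun j => N (tp_pt p j, tp_pt p j.+1))
  (tp_size p) (fun j m => expR (a j * m%:R))
  (fun j => expR (integral_oc (tp_pt p j) (tp_pt p j.+1) f * (expR (a j) - 1)))).
- by rewrite expR_sum.
- exact: loss_counts_indep.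
- by move=> j m; exact: expR_ge0.
- move=> j jp.
  apply: poisson_exp_moment; last exact: (hN.1 _ (loss_intervals_tp jp)).
  apply: integral_oc_gt0; first exact: tp_pt_lt.
    by apply: integrableS f_int; [exact: measurable_oc..|exact: tp_cell_sub].
  move=> x xj; apply: f_pos; have := @tp_cell_sub _ _ p j jp x.
  by rewrite /tp_cell/= !in_itv/=; exact.
Qed.

End loss_counts.

(** * Riemann integrability *)

Section mesh_filter.
Context (R : realType) (xm : R).
Implicit Types p : tagged_partition xm.

Lemma tp_width_le_mesh p j : (j < tp_size p)%N ->
  tp_pt p j.+1 - tp_pt p j <= mesh p.
Proof.
move=> jp; rewrite /mesh.
exact: (le_bigmax _ (fun j : 'I_(tp_size p) => tp_pt p j.+1 - tp_pt p j)
  (Ordinal jp)).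
Qed.

Lemma sum_tp_width p : \sum_(j < tp_size p) (tp_pt p j.+1 - tp_pt p j) = xm.
Proof.
rewrite -(big_mkord xpredT (fun j => tp_pt p j.+1 - tp_pt p j)).
by rewrite telescope_sumr// tp_pt_last tp_pt_first subr0.
Qed.

(** The division points stay, hence so does the mesh: two Riemann sums over the same cells can be
    compared. *)
Definition retag p (tag : nat -> R)
    (tag_in : forall j, (j < tp_size p)%N ->
      tp_pt p j < tag j <= tp_pt p j.+1) : tagged_partition xm :=
  TaggedPartition (tp_pt_first p) (tp_pt_last p) (@tp_pt_lt _ _ p) tag_in.

Context (xm0 : 0 < xm).

Lemma fine_tagged_partition (e : R) : 0 < e ->
  exists p : tagged_partition xm, mesh p < e.
Proof.
(* Equal cells of width [xm / n], which is below [e] because [n] exceeds [xm / e]; the tags are the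
   right endpoints. *)
move=> e0; pose n := (Num.truncn (xm / e)).+1.
have n0 : 0 < n%:R :> R by rewrite ltr0n.
pose t j := xm * (j%:R / n%:R).
have t0 : t 0%N = 0 by rewrite /t mul0r mulr0.
have tn : t n = xm by rewrite /t divff ?mulr1// gt_eqF.
have tS j : t j.+1 - t j = xm / n%:R.
  by rewrite /t -mulrBr -mulrBl -natrB// subSnn mul1r.
have tlt j : t j < t j.+1 by rewrite -subr_gt0 tS divr_gt0.
have ttag j : (j < n)%N -> t j < t j.+1 <= t j.+1 by rewrite tlt lexx.
exists (TaggedPartition t0 tn (fun j _ => tlt j) ttag).
apply/bigmax_ltP; split=> // j _ /=.
by rewrite tS ltr_pdivrMr// mulrC -ltr_pdivrMr// truncnS_gt.
Qed.

(** Properness comes from the existence of arbitrarily fine partitions and makes limits along the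
    mesh unique. *)
Global Instance mesh_to0_proper_filter : ProperFilter (@mesh_to0 R xm).
Proof.
apply: filter_from_proper; last first.
  by move=> e /= e0; have [p pe] := fine_tagged_partition e0; exists p.
apply: filter_from_filter; first by exists 1 => /=.
move=> e1 e2 /= e10 e20; exists (Num.min e1 e2); first by rewrite lt_min e10.
by move=> p /=; rewrite lt_min => /andP[].
Qed.

(* The bounds lo and hi stay in [0, M] so that the gaps, too, are bounded: the
   truncation argument needs this where f is large. *)
Definition darboux_integrable (M : R) (g : R -> R) : Prop :=
  forall e : R, 0 < e -> exists2 dl : R, 0 < dl & forall p, mesh p < dl ->
    exists lo hi : nat -> R,
    [/\ forall j x, (j < tp_size p)%N -> tp_cell p j x -> lo j <= g x <= hi j,
        forall j, (j < tp_size p)%N -> 0 <= lo j <= hi j /\ hi j <= M &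
        \sum_(j < tp_size p) (hi j - lo j) * (tp_pt p j.+1 - tp_pt p j) < e].

Lemma darboux_integrable_id : darboux_integrable xm id.
Proof.
(* The gap of a cell is its width, at most the mesh, so the gap sum is at most [e / 2]; the factor 2
   yields a strict final inequality. *)
move=> e e0; exists (e / (2 * xm)); first by rewrite divr_gt0// mulr_gt0.
move=> p pe; exists (tp_pt p), (fun j => tp_pt p j.+1); split.
- by move=> j x jp; rewrite /tp_cell/= in_itv/= => /andP[/ltW -> ->].
- move=> j jp; split; last exact: tp_pt_le_last.
  by rewrite (tp_pt_ge0 (ltnW jp)) (ltW (tp_pt_lt jp)).
- apply: (@le_lt_trans _ _ (\sum_(j < tp_size p)
      (e / (2 * xm)) * (tp_pt p j.+1 - tp_pt p j))).
    apply: ler_sum => j _; apply: ler_wpM2r.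
      by rewrite subr_ge0 ltW// tp_pt_lt.
    by apply: (le_trans (tp_width_le_mesh (ltn_ord j))); exact: ltW.
  rewrite -mulr_sumr sum_tp_width invfM mulrA divfK ?gt_eqF//.
  by rewrite ltr_pdivrMr// ltr_pMr// ltr1n.
Qed.

(** On one fine set of cells, tags that nearly attain the suprema and tags that nearly attain the
    infima give Riemann sums close to the same limit. Their difference is nearly the Darboux gap. *)
Lemma riemann_darboux_integrable (r : R -> R) : riemann_integrable xm r ->
  (forall x : R, 0 < x <= xm -> 0 <= r x <= xm) -> darboux_integrable xm r.
Proof.
move=> /cvg_ex[l rl] r_bnd e e0.
have e4 : 0 < e / 4 by rewrite divr_gt0.
have /cvgrPdist_lt/(_ _ e4)[dl dl0 Hdl] := rl.
exists dl => // p pdl.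
pose im j := r @` tp_cell p j.
have r_cell j x : (j < tp_size p)%N -> tp_cell p j x -> 0 <= r x <= xm.
  move=> jp /(tp_cell_sub jp); rewrite /= in_itv/=; exact: r_bnd.
have im0 j : (j < tp_size p)%N -> im j !=set0.
  by move=> jp; exists (r (tp_tag p j)), (tp_tag p j) => //; exact: tp_cell_tag.
have hlb j : (j < tp_size p)%N -> lbound (im j) 0.
  by move=> jp _ [x xj <-]; have /andP[] := r_cell j x jp xj.
have hub j : (j < tp_size p)%N -> ubound (im j) xm.
  by move=> jp _ [x xj <-]; have /andP[] := r_cell j x jp xj.
have hinf j : (j < tp_size p)%N -> has_inf (im j).
  by move=> jp; split; [exact: im0|exists 0; exact: hlb].
have hsup j : (j < tp_size p)%N -> has_sup (im j).
  by move=> jp; split; [exact: im0|exists xm; exact: hub].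
exists (fun j => inf (im j)), (fun j => sup (im j)); split.
- move=> j x jp xj; apply/andP; split.
    by apply: ge_inf; [exact: (hinf j jp).2|exists x].
  by apply: ub_le_sup; [exact: (hsup j jp).2|exists x].
- move=> j jp; have [y yj] := im0 j jp; split; last first.
    exact: (ge_sup (im0 j jp) (hub j jp)).
  apply/andP; split; first exact: (lb_le_inf (im0 j jp) (hlb j jp)).
  apply: (@le_trans _ _ y); first exact: (ge_inf (hinf j jp).2 yj).
  exact: (ub_le_sup (hsup j jp).2 yj).
(* The defect [2 * eta] per unit length totals [e / 2] over length [xm]; the two Riemann sums
   account for the other [e / 2]. *)
pose eta := e / 4 / xm.
have eta0 : 0 < eta by rewrite divr_gt0.
(* Indices beyond the partition get the dummy value 0, so that [choice] yields a total function. *)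
have /choice[xi xiP] : forall j, exists x, (j < tp_size p)%N ->
    tp_cell p j x /\ sup (im j) - eta < r x.
  move=> j.
  have [jp|] := boolP (j < tp_size p)%N; last by exists 0.
  by have [_ [x xj <-]] := sup_adherent eta0 (hsup j jp); exists x.
have /choice[zeta zetaP] : forall j, exists x, (j < tp_size p)%N ->
    tp_cell p j x /\ r x < inf (im j) + eta.
  move=> j.
  have [jp|] := boolP (j < tp_size p)%N; last by exists 0.
  by have [_ [x xj <-]] := inf_adherent eta0 (hinf j jp); exists x.
have xi_in j : (j < tp_size p)%N -> tp_pt p j < xi j <= tp_pt p j.+1.
  by move=> /xiP[]; rewrite /tp_cell/= in_itv.
have zeta_in j : (j < tp_size p)%N -> tp_pt p j < zeta j <= tp_pt p j.+1.
  by move=> /zetaP[]; rewrite /tp_cell/= in_itv.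
have /= := Hdl (retag xi_in) pdl; have /= := Hdl (retag zeta_in) pdl.
set Szeta := riemann_sum _ _; set Sxi := riemann_sum _ _ => Hzeta Hxi.
have Sdiff : Sxi - Szeta < e / 2.
  move: Hzeta Hxi; rewrite !ltr_norml => /andP[_ ?] /andP[? _]; lra.
apply: (@le_lt_trans _ _ (Sxi - Szeta + \sum_(j < tp_size p)
    (2 * eta) * (tp_pt p j.+1 - tp_pt p j))).
  rewrite /Sxi /Szeta /riemann_sum/= -sumrB -big_split/=.
  apply: ler_sum => j _; rewrite -mulrBl -mulrDl; apply: ler_wpM2r.
    by rewrite subr_ge0 ltW// tp_pt_lt.
  have [_ ?] := xiP j (ltn_ord j); have [_ ?] := zetaP j (ltn_ord j).
  lra.
rewrite -mulr_sumr sum_tp_width /eta -mulrA divfK ?gt_eqF//; lra.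
Qed.

End mesh_filter.

(** * Measurability by squeezing, for a complete measure *)

Section measurable_squeeze.
Context (R : realType) (d : measure_display) (T : measurableType d)
  (mu : {measure set T -> \bar R}).

(* The gaps h n - l n have infimum 0 almost everywhere, and there g is the
   supremum of the l n. *)
Lemma measurable_fun_squeeze (D : set T) (l h : nat -> T -> R) (g : T -> R) :
  measure_is_complete mu -> measurable D ->
  (forall n, measurable_fun D (l n)) -> (forall n, measurable_fun D (h n)) ->
  (forall n x, D x -> l n x <= g x <= h n x) ->
  (forall e : R, 0 < e ->
    exists n, (\int[mu]_(x in D) (h n x - l n x)%:E <= e%:E)%E) ->
  measurable_fun D g.
Proof.
move=> cmu mD ml mh lgh hl; apply/measurable_EFinP.
(* At index 0, [esups] and [einfs] range over the whole sequence. *)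
pose L x := esups (fun n => (l n x)%:E) 0.
pose delta x := einfs (fun n => (h n x - l n x)%:E) 0.
have mL : measurable_fun D L.
  by apply: measurable_fun_esups => n; exact/measurable_EFinP.
have mdelta : measurable_fun D delta.
  apply: measurable_fun_einfs => n; apply/measurable_EFinP.
  exact: measurable_funB.
have delta_le n x : (delta x <= (h n x - l n x)%:E)%E.
  by apply: ereal_inf_lbound; exists n.
have delta_ge0 x : D x -> (0 <= delta x)%E.
  move=> Dx; apply: le_ereal_inf_tmp => _ [n _ <-].
  by rewrite lee_fin subr_ge0; have /andP[lg gh] := lgh n x Dx; exact: le_trans gh.
(* For every [e], [delta] lies below some gap [h n - l n] of integral at most [e]. *)
have int_delta : (\int[mu]_(x in D) `|delta x| = 0)%E.
  apply/eqP; rewrite eq_le integral_ge0 ?andbT//.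
  apply/lee_addgt0Pr => e e0; rewrite add0e.
  have [n] := hl e e0; apply: le_trans; apply: ge0_le_integral => //.
  - exact: measurableT_comp.
  - by apply/measurable_EFinP; exact: measurable_funB.
  - by move=> x Dx; rewrite gee0_abs ?delta_ge0.
(* Completeness passes measurability from [L] to [g], which agrees with it almost everywhere. *)
apply: (ae_measurable_fun cmu _ mL).
have /(ae_eq_integral_abs mu mD mdelta) := int_delta.
apply: filterS => x /= delta0 Dx; move/(_ Dx) : delta0 => /= delta0.
apply/eqP; rewrite eq_le; apply/andP; split.
  apply: ge_ereal_sup => _ [n _ <-]; rewrite lee_fin.
  by have /andP[] := lgh n x Dx.
apply/lee_addgt0Pr => e e0.
(* Where [delta] is 0, some [l n x] is within [e] of [h n x], hence of [g x]. *)
have : (ereal_inf (sdrop (fun n => (h n x - l n x)%:E) 0) < e%:E)%E.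
  by rewrite -[X in (X < _)%E]/(delta x) delta0 lte_fin.
move=> /ereal_inf_lt[_ [n _ <-]]; rewrite lte_fin => hle.
apply: (@le_trans _ _ ((l n x)%:E + e%:E)%E).
  have /andP[_ ?] := lgh n x Dx; rewrite -EFinD lee_fin; lra.
by apply: leeD => //; apply: ereal_sup_ubound; exists n.
Qed.

End measurable_squeeze.

(** * Step functions and measurability of Darboux integrable functions *)

Section darboux_measurable.
Context (R : realType) (xm : R).
Context (xm0 : 0 < xm).
Local Notation mu := (@completed_lebesgue_measure R).
Local Notation cR := (caratheodory_type (@wlength R idfun)^*%mu).

(** The argument lives in the Caratheodory type, so that measurability refers to the completed
    sigma-algebra. *)
Definition step_fun (p : tagged_partition xm) (v : nat -> R) (x : cR) : R :=
  \sum_(j < tp_size p) v j * \1_(tp_cell p j : set cR) x.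

Lemma step_funE p v j x : (j < tp_size p)%N -> tp_cell p j x ->
  step_fun p v x = v j.
Proof.
move=> jp xj; rewrite /step_fun (bigD1 (Ordinal jp))//= big1 ?addr0.
  by rewrite indicE mem_set// mulr1.
move=> i ij; rewrite indicE memNset ?mulr0// => xi.
move/negP: ij; apply; apply/eqP/val_inj.
exact: (tp_cell_uniq (ltn_ord i) jp xi xj).
Qed.

Lemma measurable_step_fun p v (D : set cR) : measurable_fun D (step_fun p v).
Proof.
apply: measurable_sum => j; apply: measurable_funM => //.
by apply: measurable_indic; exact: measurable_oc.
Qed.

Lemma integral_step_fun p (v : nat -> R) :
  (forall j, (j < tp_size p)%N -> 0 <= v j) ->
  (\int[mu]_(x in `]0%R, xm]%classic) (step_fun p v x)%:E =
   (\sum_(j < tp_size p) v j * (tp_pt p j.+1 - tp_pt p j))%:E)%E.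
Proof.
move=> v0; have mD := measurable_oc 0 xm.
under eq_integral do rewrite -sumEFin.
rewrite ge0_integral_sum//; last 2 first.
- move=> j.
  have mj : measurable_fun (`]0, xm]%classic : set cR)
      (fun x : cR => v j * \1_(tp_cell p j : set cR) x).
    apply: measurable_funM => //.
    by apply: measurable_indic; exact: measurable_oc.
  by have /measurable_EFinP := mj.
- by move=> j x _; rewrite lee_fin mulr_ge0// ?v0// indicE.
rewrite -sumEFin; apply: eq_bigr => j _.
under eq_integral do rewrite EFinM.
have mj : measurable (tp_cell p j : set cR) by exact: measurable_oc.
rewrite ge0_integralZl//; last 2 first.
- exact/measurable_EFinP/measurable_indic.
- by rewrite lee_fin v0.
rewrite integral_indic// setIidl; last exact: tp_cell_sub.
rewrite EFinM; congr (_ * _)%E.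
by apply: completed_lebesgue_measure_oc; exact/ltW/tp_pt_lt.
Qed.

(** Step functions built from cell bounds squeeze [g], with gap integrals below [1 / (n + 1)]. *)
Lemma darboux_measurable (M : R) (g : R -> R) : darboux_integrable xm M g ->
  measurable_fun (`]0, xm]%classic : set cR) g.
Proof.
move=> dg.
have e_gt0 n : 0 < n.+1%:R^-1 :> R by rewrite invr_gt0.
have /choice[p pP] : forall n, exists p : tagged_partition xm,
    exists lo hi : nat -> R,
    [/\ forall j x, (j < tp_size p)%N -> tp_cell p j x -> lo j <= g x <= hi j,
        forall j, (j < tp_size p)%N -> 0 <= lo j <= hi j /\ hi j <= M &
        \sum_(j < tp_size p) (hi j - lo j) * (tp_pt p j.+1 - tp_pt p j)
          < n.+1%:R^-1].
  move=> n; have [dl dl0 Hdl] := dg _ (e_gt0 n).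
  by have [p pdl] := fine_tagged_partition xm0 dl0; exists p; exact: Hdl.
have /choice[lo /choice[hi lohi]] := pP.
have cells n x : `]0, xm]%classic x ->
    exists2 j, (j < tp_size (p n))%N & tp_cell (p n) j x.
  by rewrite -(bigcup_tp_cell (p n)) => -[j]; exists j.
apply: (@measurable_fun_squeeze _ _ _ mu _
    (fun n => step_fun (p n) (lo n)) (fun n => step_fun (p n) (hi n))).
- exact: completed_lebesgue_measure_is_complete.
- exact: measurable_oc.
- by move=> n; exact: measurable_step_fun.
- by move=> n; exact: measurable_step_fun.
- move=> n x /(cells n)[j jp xj]; rewrite !(step_funE _ jp xj).
  by have [+ _ _] := lohi n; exact.
(* With this index, [n + 1] exceeds [1 / e]. *)
- move=> e e0; exists (Num.truncn e^-1).
  have [_ lohi_ge sum_lt] := lohi (Num.truncn e^-1).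
  set n := Num.truncn e^-1 in lohi_ge sum_lt *.
  apply: (@le_trans _ _ (\sum_(j < tp_size (p n))
      (hi n j - lo n j) * (tp_pt (p n) j.+1 - tp_pt (p n) j))%:E).
    rewrite -(@integral_step_fun (p n) (fun j => hi n j - lo n j)); last first.
      by move=> j jp; have [/andP[_ lh] _] := lohi_ge j jp; rewrite subr_ge0.
    rewrite le_eqVlt; apply/orP; left; apply/eqP.
    apply: eq_integral => x; rewrite inE => /(cells n)[j jp xj].
    by rewrite !(step_funE _ jp xj).
  rewrite lee_fin (le_trans (ltW sum_lt))// -[leRHS]invrK lef_pV2 ?posrE ?invr_gt0//.
  exact/ltW/truncnS_gt.
Qed.

End darboux_measurable.

(** * Integrals over half-open intervals *)

Section integral_oc_theory.
Context (R : realType).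
Local Notation mu := (@completed_lebesgue_measure R).
Local Notation cR := (caratheodory_type (@wlength R idfun)^*%mu).
Implicit Types (a b c : R) (f g h : R -> R).

Lemma integrable_ocW a b a' b' f : a <= a' -> b' <= b ->
  integrable_oc a b f -> integrable_oc a' b' f.
Proof.
move=> aa' bb'; apply: integrableS; [exact: measurable_oc..|].
move=> x /=; rewrite !in_itv/= => /andP[ax xb].
by rewrite (le_lt_trans aa' ax) (le_trans xb bb').
Qed.

Lemma integrable_oc_measurable a b f : integrable_oc a b f ->
  measurable_fun (`]a, b]%classic : set cR) f.
Proof. by move=> /measurable_int/measurable_EFinP. Qed.

Lemma integrable_ocM a b f h (B : R) : integrable_oc a b f ->
  measurable_fun (`]a, b]%classic : set cR) h ->
  (forall x, a < x <= b -> `|h x| <= B) ->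
  integrable_oc a b (fun x => f x * h x).
Proof.
move=> f_int mh hB.
apply: (@integrableMl _ _ _ mu _ (measurable_oc a b) _ h f_int mh).
exists B; split; first exact: num_real.
by move=> C BC x /=; rewrite in_itv/= => /hB/le_trans; apply; exact: ltW.
Qed.

Lemma integrable_oc_cst a b (k : R) : a <= b -> integrable_oc a b (fun=> k).
Proof.
move=> ab; apply: (@measurable_bounded_integrable _ _ _ mu (fun=> k) _
  (measurable_oc a b)) => //.
  by have /= -> := completed_lebesgue_measure_oc ab; exact: ltry.
exists `|k|; split; first exact: num_real.
by move=> B kB x _ /=; exact: ltW.
Qed.

Lemma integrable_ocB a b f g : integrable_oc a b f -> integrable_oc a b g ->
  integrable_oc a b (fun x => f x - g x).
Proof. exact: (integrableB (measurable_oc a b)). Qed.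

Lemma integrable_ocD a b f g : integrable_oc a b f -> integrable_oc a b g ->
  integrable_oc a b (fun x => f x + g x).
Proof. exact: (integrableD (measurable_oc a b)). Qed.

Lemma integrable_ocZl a b (k : R) f : integrable_oc a b f ->
  integrable_oc a b (fun x => k * f x).
Proof. exact: (integrableZl (measurable_oc a b)). Qed.

Lemma integral_ocB a b f g : integrable_oc a b f -> integrable_oc a b g ->
  integral_oc a b (fun x => f x - g x) = integral_oc a b f - integral_oc a b g.
Proof. exact: (RintegralB (measurable_oc a b)). Qed.

Lemma integral_ocD a b f g : integrable_oc a b f -> integrable_oc a b g ->
  integral_oc a b (fun x => f x + g x) = integral_oc a b f + integral_oc a b g.
Proof. exact: (RintegralD (measurable_oc a b)). Qed.

Lemma integral_ocZl a b (k : R) f : integrable_oc a b f ->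
  integral_oc a b (fun x => k * f x) = k * integral_oc a b f.
Proof. exact: (RintegralZl k (measurable_oc a b)). Qed.

Lemma eq_integral_oc a b f g : (forall x, a < x <= b -> f x = g x) ->
  integral_oc a b f = integral_oc a b g.
Proof.
move=> fg; apply: eq_Rintegral => x; rewrite inE/= in_itv/=; exact: fg.
Qed.

Lemma le_integral_oc a b f g : integrable_oc a b f -> integrable_oc a b g ->
  (forall x, a < x <= b -> f x <= g x) -> integral_oc a b f <= integral_oc a b g.
Proof.
move=> f_int g_int fg; exact: (le_Rintegral (measurable_oc a b)).
Qed.

Lemma integral_oc_ge0 a b f : (forall x, a < x <= b -> 0 <= f x) ->
  0 <= integral_oc a b f.
Proof.
by move=> f0; apply: Rintegral_ge0 => x /=; rewrite in_itv/=; exact: f0.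
Qed.

Lemma le_norm_integral_oc a b f : integrable_oc a b f ->
  `|integral_oc a b f| <= integral_oc a b (fun x => `|f x|).
Proof. exact: (le_normr_Rintegral (measurable_oc a b)). Qed.

Lemma integrable_oc_norm a b f : integrable_oc a b f ->
  integrable_oc a b (fun x => `|f x|).
Proof. exact: integrable_norm. Qed.

Lemma integral_oc_cst a b (k : R) : a <= b ->
  integral_oc a b (fun=> k) = k * (b - a).
Proof.
move=> ab; rewrite /integral_oc (Rintegral_cst mu (measurable_oc a b)).
by congr (_ * _); exact: (congr1 fine (completed_lebesgue_measure_oc ab)).
Qed.

Lemma integral_oc_cat a b c f : a <= b -> b <= c -> integrable_oc a c f ->
  integral_oc a c f = integral_oc a b f + integral_oc b c f.
Proof.
move=> ab bc f_int.
have acE : (`]a, c]%classic : set cR) = `]a, b]%classic `|` `]b, c]%classic.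
  apply/seteqP; split=> x /=; rewrite !in_itv/=.
    move=> /andP[-> ->]; rewrite andbT; by case: leP; [left|right].
  move=> [/andP[-> xb]|/andP[bx ->]]; first exact: le_trans bc.
  by rewrite andbT; exact: le_lt_trans bx.
rewrite /integral_oc acE Rintegral_setU//; [exact: measurable_oc|
  exact: measurable_oc| |].
  by rewrite -acE.
apply/disj_setPS => x [] /=; rewrite !in_itv/= => /andP[_ xb] /andP[bx _].
by move: (lt_le_trans bx xb); rewrite ltxx.
Qed.

Lemma integral_oc_tp (xm : R) (p : tagged_partition xm) f :
  integrable_oc 0 xm f ->
  integral_oc 0 xm f =
  \sum_(j < tp_size p) integral_oc (tp_pt p j) (tp_pt p j.+1) f.
Proof.
(* The upper limit is written as a division point so that the induction can run over the first [k]
   cells. *)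
move=> f_int; suff {1}<- : tp_pt p (tp_size p) = xm.
  elim: {-2}(tp_size p) (leqnn (tp_size p)) => [_|k IH kp].
    rewrite big_ord0 tp_pt_first (@eq_integral_oc _ _ _ (fun=> 0)).
      by rewrite integral_oc_cst// mul0r.
    by move=> x /andP[/lt_le_trans/[apply]]; rewrite ltxx.
  rewrite big_ord_recr/= -IH; last exact: ltnW.
  apply: integral_oc_cat.
  - exact/tp_pt_ge0/ltnW.
  - exact/ltW/tp_pt_lt.
  - by apply: integrable_ocW f_int => //; exact: tp_pt_le_last.
exact: tp_pt_last.
Qed.

Lemma measurable_excess a b f (k : R) : integrable_oc a b f ->
  measurable_fun (`]a, b]%classic : set cR) (fun x => Num.max (f x - k) 0).
Proof.
move=> /integrable_oc_measurable mf.
apply: measurable_maxr => //; apply: measurable_funB => //.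
Qed.

Lemma integrable_excess a b f (k : R) : 0 <= k -> integrable_oc a b f ->
  integrable_oc a b (fun x => Num.max (f x - k) 0).
Proof.
move=> k0 f_int; apply: (le_integrable (measurable_oc a b) _ _ f_int).
  exact/measurable_EFinP/measurable_excess.
move=> x _ /=; rewrite lee_fin ger0_norm; last by rewrite le_max lexx orbT.
by rewrite ge_max normr_ge0 andbT (le_trans _ (ler_norm _))// gerBl.
Qed.

(** Dominated convergence with bound [|f|]: at each point the excess is 0 once [n] exceeds [f x]. *)
Lemma integral_oc_excess_cvg0 a b f : integrable_oc a b f ->
  (integral_oc a b (fun x => Num.max (f x - n%:R) 0) @[n --> \oo] --> (0 : R)).
Proof.
move=> f_int; apply: (@fine_cvg _ _ _ _ _ 0).
have := @dominated_convergence _ _ _ mu _ (measurable_oc a b)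
  (fun n x => (Num.max (f x - n%:R) 0)%:E) (cst 0%E) (abse \o (EFin \o f)).
move=> [].
- by move=> n; exact/measurable_EFinP/measurable_excess.
- exact: measurable_cst.
- apply: aeW => x _; apply: cvg_near_cst.
  exists (Num.truncn (f x)).+1 => // n /= fxn.
  congr EFin; apply/max_idPr; rewrite subr_le0.
  by apply: (le_trans (ltW (truncnS_gt (f x)))); rewrite ler_nat.
- exact: integrable_abse.
- apply: aeW => x n _ /=.
  rewrite lee_fin ger0_norm; last by rewrite le_max lexx orbT.
  by rewrite ge_max normr_ge0 andbT (le_trans _ (ler_norm _))// gerBl.
- by move=> _ _; rewrite integral0.
Qed.

End integral_oc_theory.

(** * Convergence of Riemann sums weighted by the masses of [f] *)

Section weighted_riemann_sums.
Context (R : realType) (xm : R).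
Context (xm0 : 0 < xm).
Local Notation mu := (@completed_lebesgue_measure R).
Local Notation cR := (caratheodory_type (@wlength R idfun)^*%mu).

Context (f : R -> R).
Context (f_ge0 : forall x : R, 0 < x <= xm -> 0 <= f x).
Context (f_int : integrable_oc 0 xm f).

Context (g : R -> R) (M : R) (phi : R -> R) (C : R).
Context (g_darboux : darboux_integrable xm M g).
Context (g_bnd : forall x : R, 0 < x <= xm -> 0 <= g x <= M).
Context (mphi : measurable_fun [set: R] phi).
Context (C_gt0 : 0 < C).
Context (phi_lip :
  forall y z : R, 0 <= y <= M -> 0 <= z <= M -> `|phi y - phi z| <= C * `|y - z|).

(** The second factor is measurable, since [g] is Darboux integrable, and bounded by comparison with
    [phi 0]. *)
Lemma integrable_lipschitz_comp : integrable_oc 0 xm (fun x => f x * phi (g x)).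
Proof.
have M0 : 0 <= M.
  have /g_bnd/andP[g0 gM] : 0 < xm <= xm by rewrite xm0 lexx.
  exact: le_trans gM.
apply: (@integrable_ocM _ _ _ _ (fun x => phi (g x)) (`|phi 0| + C * M)) => //.
  exact: measurableT_comp (darboux_measurable xm0 g_darboux).
move=> x /g_bnd gx; have /andP[gx0 gxM] := gx.
rewrite -[phi (g x)](subrK (phi 0)) addrC (le_trans (ler_normD _ _))// lerD2l.
apply: (le_trans (phi_lip gx _)); first by rewrite lexx.
by rewrite subr0 ger0_norm// ler_pM2l.
Qed.

Lemma cell_bounds (p : tagged_partition xm) j x : (j < tp_size p)%N ->
  tp_pt p j < x <= tp_pt p j.+1 -> 0 < x <= xm.
Proof.
by move=> jp xj; have := @tp_cell_sub _ _ p j jp x; rewrite /tp_cell/= !in_itv; apply.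
Qed.

(** The values of [g] at the tag and at any point of the cell differ by at most [hi j - lo j]; the
    Lipschitz bound on [phi] is then integrated against [f]. *)
Lemma cell_error (p : tagged_partition xm) (lo hi : nat -> R) j :
  (j < tp_size p)%N ->
  (forall x, tp_cell p j x -> lo j <= g x <= hi j) ->
  `|integral_oc (tp_pt p j) (tp_pt p j.+1) f * phi (g (tp_tag p j)) -
    integral_oc (tp_pt p j) (tp_pt p j.+1) (fun x => f x * phi (g x))| <=
  C * (hi j - lo j) * integral_oc (tp_pt p j) (tp_pt p j.+1) f.
Proof.
move=> jp lohi.
have sub a : integrable_oc 0 xm a ->
    integrable_oc (tp_pt p j) (tp_pt p j.+1) a.
  by apply: integrable_ocW; [exact/tp_pt_ge0/ltnW|exact: tp_pt_le_last].
have i1 := sub _ f_int; have i2 := sub _ integrable_lipschitz_comp.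
rewrite [integral_oc _ _ f * phi _]mulrC -[phi _ * _]integral_ocZl//.
rewrite -integral_ocB//; last exact: integrable_ocZl.
have i3 := integrable_ocB (integrable_ocZl (phi (g (tp_tag p j))) i1) i2.
apply: (le_trans (le_norm_integral_oc i3)).
rewrite -integral_ocZl//; apply: le_integral_oc.
- exact: integrable_oc_norm.
- exact: integrable_ocZl.
- move=> x xj; have f0 := f_ge0 (cell_bounds jp xj).
  rewrite [phi _ * _]mulrC -mulrBr normrM ger0_norm// mulrC ler_wpM2r//.
  apply: (le_trans (phi_lip (g_bnd (cell_bounds jp (tp_tag_in jp)))
                            (g_bnd (cell_bounds jp xj)))).
  rewrite ler_pM2l// ler_norml.
  have := lohi x; rewrite /tp_cell/= in_itv/= => /(_ xj).
  have := lohi _ (tp_cell_tag jp) => /andP[? ?] /andP[? ?].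
  by apply/andP; split; lra.
Qed.

(** Pointwise, [f] is at most [K] plus its excess over [K]. This trades mass for length, which the
    Darboux gap controls. *)
Lemma cell_integral_le (p : tagged_partition xm) j (K : R) :
  (j < tp_size p)%N -> 0 <= K ->
  integral_oc (tp_pt p j) (tp_pt p j.+1) f <=
  K * (tp_pt p j.+1 - tp_pt p j) +
  integral_oc (tp_pt p j) (tp_pt p j.+1) (fun x => Num.max (f x - K) 0).
Proof.
move=> jp K0; have jj := ltW (tp_pt_lt jp).
have i1 : integrable_oc (tp_pt p j) (tp_pt p j.+1) f.
  by apply: integrable_ocW f_int; [exact/tp_pt_ge0/ltnW|exact: tp_pt_le_last].
have i2 := integrable_excess K0 i1; have i3 := integrable_oc_cst K jj.
rewrite -integral_oc_cst// -integral_ocD//; apply: le_integral_oc => //.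
  exact: integrable_ocD.
by move=> x _; rewrite -lerBlDl le_max lexx.
Qed.

Lemma weighted_riemann_sum_cvg :
  \sum_(j < tp_size p) integral_oc (tp_pt p j) (tp_pt p j.+1) f *
    phi (g (tp_tag p j)) @[p --> @mesh_to0 R xm] -->
  integral_oc 0 xm (fun x => f x * phi (g x)).
Proof.
have PF := mesh_to0_proper_filter xm0.
have M0 : 0 <= M.
  have /g_bnd/andP[g0 gM] : 0 < xm <= xm by rewrite xm0 lexx.
  exact: le_trans gM.
apply/cvgrPdist_le => e e0.
(* [K0] bounds [C] times any cell gap; the added 1 keeps it positive when [M = 0]. *)
pose K0 := C * (M + 1).
have K0gt0 : 0 < K0 by rewrite mulr_gt0// ltr_wpDl.
have /cvgrPdist_le/(_ (e / 2 / K0)) := integral_oc_excess_cvg0 f_int.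
rewrite !divr_gt0// => /(_ isT)[n _ /(_ n (leqnn n))] /=.
rewrite sub0r normrN ger0_norm; last first.
  by apply: integral_oc_ge0 => x _; rewrite le_max lexx orbT.
set K := n%:R => excess_le.
have K_ge0 : 0 <= K by exact: ler0n.
(* The truncation level [K] is fixed first, and the Darboux tolerance depends on it. *)
have e'0 : 0 < e / 2 / (C * (K + 1)).
  by rewrite !divr_gt0// mulr_gt0// ltr_wpDl.
have [dl dl0 Hdl] := g_darboux e'0.
exists dl => // p /Hdl[lo [hi [lohi lohi_bnd osc]]].
rewrite (integral_oc_tp p integrable_lipschitz_comp) distrC -sumrB.
apply: (le_trans (ler_norm_sum _ _ _)).
pose ex j := integral_oc (tp_pt p j) (tp_pt p j.+1)
   (fun x => Num.max (f x - K) 0).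
apply: (@le_trans _ _ (\sum_(j < tp_size p)
   (C * (K + 1) * ((hi j - lo j) * (tp_pt p j.+1 - tp_pt p j)) + K0 * ex j))).
  apply: ler_sum => j _.
  have jp := ltn_ord j.
  have [/andP[lo0 lh] hM] := lohi_bnd j jp.
  apply: (le_trans (cell_error jp (fun x => lohi j x jp))).
  have ex0 : 0 <= ex j.
    by apply: integral_oc_ge0 => x _; rewrite le_max lexx orbT.
  have w0 : 0 <= tp_pt p j.+1 - tp_pt p j by rewrite subr_ge0 ltW// tp_pt_lt.
  apply: (@le_trans _ _ (C * (hi j - lo j) *
      (K * (tp_pt p j.+1 - tp_pt p j) + ex j))).
    apply: ler_wpM2l; first by rewrite mulr_ge0 ?subr_ge0// ltW.
    exact: cell_integral_le.
  (* Against the length the gap is kept, to be summed over the cells; against the excess it is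
     bounded by [M + 1]. *)
  rewrite mulrDr; apply: lerD.
    rewrite -!mulrA ler_pM2l// mulrCA ler_wpM2r ?lerDl//.
    by rewrite mulr_ge0// subr_ge0.
  by apply: ler_wpM2r => //; rewrite /K0 ler_pM2l//; lra.
rewrite big_split/= -!mulr_sumr -(integral_oc_tp p (integrable_excess K_ge0 f_int)).
rewrite [leRHS](splitr e); apply: lerD.
  by rewrite -ler_pdivlMl ?mulr_gt0 ?ltr_wpDl// mulrC ltW.
by rewrite -ler_pdivlMl// mulrC.
Qed.

End weighted_riemann_sums.

(** * Certain equivalents *)

Section exponential_disutility.
Context (R : realType) (rho : R).
Context (rho0 : 0 < rho).

Lemma exp_disutility_inj : injective (exp_disutility rho).
Proof.
move=> x y /(mulfI (lt0r_neq0 rho0))/addIr/expR_inj.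
by apply: mulIf; rewrite invr_eq0 lt0r_neq0.
Qed.

Lemma exp_disutility_continuous : continuous (exp_disutility rho).
Proof.
move=> x; apply: cvgM; first exact: cvg_cst.
apply: cvgB; last exact: cvg_cst.
apply: (cvg_comp (fun l => l / rho) expR); last exact: continuous_expR.
by apply: cvgM; [exact: cvg_id|exact: cvg_cst].
Qed.

(** For [z <= y], the inequality [1 + t <= expR t] at [t = - (y - z) / rho] bounds the difference by
    [expR (y / rho) * ((y - z) / rho)]. *)
Lemma expR_div_lipschitz (M y z : R) : 0 <= y <= M -> 0 <= z <= M ->
  `|(expR (y / rho) - 1) - (expR (z / rho) - 1)| <=
  expR (M / rho) / rho * `|y - z|.
Proof.
wlog zy : y z / z <= y.
  move=> H yM zM; have [/H|/ltW/H] := leP z y; first exact.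
  by rewrite distrC (distrC y z); exact.
move=> /andP[_ yM] _; rewrite opprB addrA subrK.
rewrite !ger0_norm ?subr_ge0 ?ler_expR ?ler_pM2r ?invr_gt0//.
apply: (@le_trans _ _ (expR (y / rho) * ((y - z) / rho))).
  have -> : expR (z / rho) = expR (y / rho) * expR (- ((y - z) / rho)).
    by rewrite -expRD; congr expR; field; rewrite gt_eqF.
  rewrite -{1}[expR (y / rho)]mulr1 -mulrBr ler_pM2l ?expR_gt0//.
  have := expR_ge1Dx (- ((y - z) / rho)); lra.
rewrite -mulrA [rho^-1 * _]mulrC ler_wpM2r//.
  by rewrite divr_ge0 ?subr_ge0// ltW.
by rewrite ler_expR ler_pM2r ?invr_gt0.
Qed.

Lemma measurable_exp_ratio :
  measurable_fun [set: R] (fun y => expR (y / rho) - 1).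
Proof.
by apply: measurable_funB => //; apply: measurableT_comp => //;
  exact: measurable_funM.
Qed.

Lemma lipschitz_gt0 (M : R) : 0 < expR (M / rho) / rho.
Proof. by rewrite divr_gt0 ?expR_gt0. Qed.

Context (xm : R) (d : measure_display) (Omega : measurableType d)
  (Pr : probability Omega R).

(** The limit is unique and [exp_disutility rho] is injective, so its partial inverse returns
    [ce]. *)
Lemma certain_equivalentE (Y : tagged_partition xm -> Omega -> R) (ce : R) :
  0 < xm ->
  'E_Pr[fun w => exp_disutility rho (Y p w)]%E @[p --> @mesh_to0 R xm] -->
    (exp_disutility rho ce)%:E ->
  certain_equivalent_defined Pr (exp_disutility rho) Y /\
  certain_equivalent Pr (exp_disutility rho) Y = ce.
Proof.
move=> xm0 cvg_ce; have PF := mesh_to0_proper_filter xm0; split.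
  by exists (exp_disutility rho ce) => //; exists ce.
rewrite /certain_equivalent /expected_disutility (cvg_lim _ cvg_ce)//=.
by rewrite pinvKV ?inE// => x y _ _; exact: exp_disutility_inj.
Qed.

Context (f : R -> R) (N : R * R -> {RV Pr >-> nat}).
Context (xm0 : 0 < xm).
Context (f_pos : forall x : R, 0 < x <= xm -> 0 < f x).
Context (f_int : integrable_oc 0 xm f).
Context (hN : poisson_loss_counts xm f N).

(** The disutility is affine in the product [Z] of exponentials, whose expectation is [expR S]. Thus
    [c + rho * S] is the exact certain equivalent at each partition, before any limit. *)
Lemma expectation_exp_disutility (p : tagged_partition xm) (g : R -> R) (c : R) :
  ('E_Pr[fun w => exp_disutility rho (c + discretized_total N g p w)] =
   (exp_disutility rho (c + rho * \sum_(j < tp_size p)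
     integral_oc (tp_pt p j) (tp_pt p j.+1) f *
       (expR (g (tp_tag p j) / rho) - 1)))%:E)%E.
Proof.
set S := \sum_(j < _) _.
pose Z w := \prod_(j < tp_size p)
  expR (g (tp_tag p j) / rho * (N (tp_pt p j, tp_pt p j.+1) w)%:R).
have intZ : (\int[Pr]_w (Z w)%:E = (expR S)%:E)%E.
  exact: (expectation_exp_loss_counts hN p (fun j => g (tp_tag p j) / rho)).
have mZ : measurable_fun [set: Omega] Z.
  exact: (measurable_prod_nat (fun j => N (tp_pt p j, tp_pt p j.+1))
    (fun j m => expR (g (tp_tag p j) / rho * m%:R)) (tp_size p)).
(* [Z] is nonnegative, so its finite expectation already gives integrability. *)
have iZ : Pr.-integrable [set: Omega] (EFin \o Z).
  apply/integrableP; split; first exact/measurable_EFinP.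
  under eq_integral do rewrite gee0_abs ?lee_fin ?prodr_ge0//.
  by rewrite intZ ltry.
rewrite unlock.
transitivity (\int[Pr]_w ((rho * expR (c / rho)) * Z w - rho)%:E)%E.
  apply: eq_integral => w _; congr EFin.
  rewrite /exp_disutility mulrBr mulr1 -mulrA; congr (_ * _ - _).
  rewrite mulrDl expRD; congr (_ * _).
  rewrite /discretized_total mulr_suml expR_sum; apply: eq_bigr => j _.
  by congr expR; rewrite -mulrA mulrC.
rewrite integralB_EFin//; last 2 first.
- exact: (@integrableZl _ _ _ Pr _ measurableT (rho * expR (c / rho)) _ iZ).
- exact: (finite_measure_integrable_cst Pr rho).
under eq_integral do rewrite EFinM.
rewrite integralZl// intZ integral_cst//.
rewrite [X in (_ - _ * X)%E](_ : _ = 1%E); last exact: probability_setT.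
rewrite mule1 -EFinM -EFinB.
congr EFin; rewrite /exp_disutility.
have -> : (c + rho * S) / rho = c / rho + S by field; rewrite gt_eqF.
by rewrite expRD; ring.
Qed.

(** The discretized certain equivalents converge by [weighted_riemann_sum_cvg], and continuity of
    the disutility carries the limit over. The constant [c] lets one statement serve both the total
    loss and the retention plus premium. *)
Lemma certain_equivalent_total (g : R -> R) (c : R)
    (Y : tagged_partition xm -> Omega -> R) :
  darboux_integrable xm xm g -> (forall x : R, 0 < x <= xm -> 0 <= g x <= xm) ->
  (forall p w, Y p w = c + discretized_total N g p w) ->
  certain_equivalent_defined Pr (exp_disutility rho) Y /\
  certain_equivalent Pr (exp_disutility rho) Y =
    c + rho * integral_oc 0 xm (fun x => f x * (expR (g x / rho) - 1)).
Proof.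
move=> dg g_bnd YE; apply: certain_equivalentE => //.
have PF := mesh_to0_proper_filter xm0.
rewrite (_ : (fun p => _) = fun p => (exp_disutility rho (c + rho *
    \sum_(j < tp_size p) integral_oc (tp_pt p j) (tp_pt p j.+1) f *
      (expR (g (tp_tag p j) / rho) - 1)))%:E); last first.
  apply/funext => p; rewrite -expectation_exp_disutility.
  by congr expectation; apply/funext => w; rewrite YE.
apply: cvg_EFin; first exact: nearW.
have S_cvg := weighted_riemann_sum_cvg xm0 (fun x x0 => ltW (f_pos x0)) f_int
  dg g_bnd measurable_exp_ratio (lipschitz_gt0 xm) (@expR_div_lipschitz xm).
apply: (cvg_comp (fun p => c + rho * \sum_(j < tp_size p)
    integral_oc (tp_pt p j) (tp_pt p j.+1) f * (expR (g (tp_tag p j) / rho) - 1))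
  (exp_disutility rho)); last exact: exp_disutility_continuous.
by apply: cvgD; [exact: cvg_cst|apply: cvgM S_cvg; exact: cvg_cst].
Qed.

Lemma integrable_exp_comp (g : R -> R) :
  darboux_integrable xm xm g -> (forall x : R, 0 < x <= xm -> 0 <= g x <= xm) ->
  integrable_oc 0 xm (fun x => f x * (expR (g x / rho) - 1)).
Proof.
move=> dg g_bnd; exact: (integrable_lipschitz_comp xm0 f_int dg g_bnd
  measurable_exp_ratio (lipschitz_gt0 xm) (@expR_div_lipschitz xm)).
Qed.

End exponential_disutility.

Theorem mainTheorem2 (R : realType) (d : measure_display)
    (Omega : measurableType d) (Pr : probability Omega R)
    (xm : R) (hxm : 0 < xm)
    (f : R -> R)
    (f_pos : forall x, 0 < x <= xm -> 0 < f x)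
    (f_int : integrable_oc 0 xm f)
    (r : R -> R)
    (r_int : riemann_integrable xm r)
    (r_bnd : forall x, 0 < x <= xm -> 0 <= r x <= x)
    (rho : R) (hrho : 0 < rho)
    (prem : R) (hprem : 0 <= prem)
    (N : R * R -> {RV Pr >-> nat})
    (hN : poisson_loss_counts xm f N) :
  let U := exp_disutility rho in
  let X := fun p : tagged_partition xm => discretized_total N id p in
  let RP := fun (p : tagged_partition xm) (w : Omega) =>
    prem + discretized_total N r p w in
  let V_ins := certain_equivalent Pr U X - certain_equivalent Pr U RP in
  (certain_equivalent_defined Pr U X /\ certain_equivalent_defined Pr U RP) /\
  [/\ certain_equivalent Pr U X =
        rho * integral_oc 0 xm (fun x => f x * (expR (x / rho) - 1)),
      certain_equivalent Pr U RP =
        prem + rho * integral_oc 0 xm (fun x => f x * (expR (r x / rho) - 1)),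
      V_ins =
        rho * integral_oc 0 xm
                (fun x => f x * (expR (x / rho) - expR (r x / rho))) - prem &
      forall c : R,
        prem = (1 + c) * integral_oc 0 xm (fun x => f x * (x - r x)) ->
        V_ins =
          rho * integral_oc 0 xm
                  (fun x => f x * (expR (x / rho) - expR (r x / rho)
                                   - (1 + c) * (x / rho - r x / rho)))].
Proof.
move=> U X RP V_ins.
have id_bnd x : 0 < x <= xm -> 0 <= (id x : R) <= xm.
  by move=> /andP[/ltW -> ->].
have r_bnd' (x : R) : 0 < x <= xm -> 0 <= r x <= xm.
  by move=> x0; have /andP[-> /le_trans->//] := r_bnd x x0; case/andP: x0.
have id_darboux := darboux_integrable_id hxm.
have r_darboux := riemann_darboux_integrable hxm r_int r_bnd'.
have [defX ceX] := certain_equivalent_total hrho hxm f_pos f_int hN (c := 0)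
  (Y := X) id_darboux id_bnd (fun p w => esym (add0r _)).
have [defRP ceRP] := certain_equivalent_total hrho hxm f_pos f_int hN
  (c := prem) (Y := RP) r_darboux r_bnd' (fun p w => erefl).
rewrite add0r in ceX.
have iX := integrable_exp_comp hrho hxm f_int id_darboux id_bnd.
have iR := integrable_exp_comp hrho hxm f_int r_darboux r_bnd'.
(* The constants [- 1] of the two integrands cancel. *)
have VE : V_ins = rho * integral_oc 0 xm
    (fun x => f x * (expR (x / rho) - expR (r x / rho))) - prem.
  rewrite /V_ins ceX ceRP opprD addrCA addrC -mulrBr -integral_ocB//.
  congr (_ * _ - _); apply: eq_integral_oc => x _.
  by rewrite /=; ring.
split=> //; split=> // c premE.
have mid := darboux_measurable hxm id_darboux.
have mr := darboux_measurable hxm r_darboux.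
have iE : integrable_oc 0 xm (fun x => f x * (expR (x / rho) - expR (r x / rho))).
  rewrite (_ : (fun x => _) = fun x =>
      f x * (expR (id x / rho) - 1) - f x * (expR (r x / rho) - 1)).
    exact: integrable_ocB.
  by apply/funext => x /=; ring.
have iL : integrable_oc 0 xm (fun x => f x * (x - r x)).
  apply: (@integrable_ocM _ _ _ _ _ xm f_int); first exact: measurable_funB.
  move=> x x0; have /andP[_ xxm] := x0; have /andP[r0 rx] := r_bnd x x0.
  by rewrite ger0_norm ?subr_ge0// (le_trans _ xxm)// gerBl.
rewrite VE premE.
(* The premium is brought under an integral with the same outer factor [rho], which puts [1 / rho]
   into its integrand. *)
rewrite (_ : (1 + c) * _ = rho * integral_oc 0 xm
    (fun x => (1 + c) / rho * (f x * (x - r x)))); last first.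
  by rewrite integral_ocZl//; field; rewrite gt_eqF.
rewrite -mulrBr -integral_ocB//; last exact: integrable_ocZl.
by congr (_ * _); apply: eq_integral_oc => x _; field; rewrite gt_eqF.
Qed.
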